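(* Let $r$ be a positive integer and let $\lambda=(\lambda_1,\dots,\lambda_s)$ be an ordered partition of $r$. For every collectable $r$-pattern $P$ let $m_P$ be a positive integer. Let $\mathcal{H}$ be a finite collection of pairwise disjoint subsets $e\subseteq\mathbb{Z}$, each of size $|e|=r$, such that $\mathcal{H}$ is $\lambda$-partite, and assume that for every collectable $r$-pattern $P$, every $P$-clique contained in $\mathcal{H}$ has size at most $m_P$. Then \[|\mathcal{H}|\le 2^{r-s}\sum_{\lambda^{(s)}\succ\lambda^{(s+1)}\succ\dots\succ\lambda^{(r)}}\ \prod_{P\in\mathcal{P}(\lambda^{(s)})\cup\dots\cup\mathcal{P}(\lambda^{(r)})} m_P,\] where the sum is over all sequences $\lambda^{(s)}\succ\lambda^{(s+1)}\succ\dots\succ\lambda^{(r)}$ of ordered partitions of $r$ with $\lambda^{(s)}=\lambda$.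
   Context: $\mathcal{H}$ is regarded as an ordered $r$-uniform hypergraph matching with the natural order of $\mathbb{Z}$. An $r$-pattern is a string in $\{\mathrm{A},\mathrm{B}\}^{2r}$ starting with $\mathrm{A}$ with exactly $r$ letters $\mathrm{A}$ and $r$ letters $\mathrm{B}$. Two distinct $e,f\in\mathcal{H}$ form the $r$-pattern obtained by listing $e\cup f$ in increasing order, writing $\mathrm{A}$ for elements of the set containing $\min(e\cup f)$ and $\mathrm{B}$ for the other. A $P$-clique is a subcollection any two distinct members of which form $P$; its size is its cardinality. A block partition of an $r$-pattern is a division into consecutive blocks each reading $\mathrm{A}^k\mathrm{B}^k$ or $\mathrm{B}^k\mathrm{A}^k$ ($k\ge1$); it is unique if it exists, and $P$ is collectable if it exists. An ordered partition of $r$ is a sequence $(\lambda_1,\dots,\lambda_s)$ of positive integers summing to $r$, with $s$ parts. $\lambda\succ\lambda'$ means $\lambda'$ is obtained from $\lambda$ by splitting some summands into consecutive smaller summands (as partitions of $\{1,\dots,r\}$ into intervals, $\lambda'$ refines $\lambda$); in a chain $\lambda^{(s)}\succ\dots\succ\lambda^{(r)}$ with $\lambda^{(s)}$ having $s$ parts, $\lambda^{(t)}$ has $t$ parts. $\mathcal{P}(\lambda)$ is the set of collectable $r$-patterns whose block partition consists of $s$ blocks of lengths $2\lambda_1,\dots,2\lambda_s$ in this order. $\mathcal{H}$ is $\lambda$-partite if there are $x_0<x_1<\dots<x_s$ in $\mathbb{R}\setminus\mathbb{Z}$ with $|e\cap(x_{i-1},x_i)|=\lambda_i$ for all $e\in\mathcal{H}$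 and all $i=1,\dots,s$. *)

(* Defs.v *)
From HB Require Import structures.
From mathcomp Require Import all_boot all_order all_algebra.
From mathcomp Require Import finmap boolp reals.

Set Implicit Arguments.
Unset Strict Implicit.
Unset Printing Implicit Defensive.

Import Order.TTheory GRing.Theory Num.Theory.

(* The letter A is encoded as [true] and the letter B as [false]. *)
Definition is_pattern (r : nat) (P : r.*2.-tuple bool) : Prop :=
  [/\ ohead P = Some true, count_mem true P = r & count_mem false P = r].

Definition is_block (b : seq bool) : Prop :=
  exists k : nat, 0 < k /\
    (b = nseq k true ++ nseq k false \/ b = nseq k false ++ nseq k true).

Definition block_partition (P : seq bool) (bs : seq (seq bool)) : Prop :=
  (forall b, b \in bs -> is_block b) /\ flatten bs = P.

Definition collectable (r : nat) (P : r.*2.-tuple bool) : Prop :=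
  is_pattern P /\ exists bs, block_partition P bs.

Definition formed_pattern (e f : {fset int}) : seq bool :=
  let u := sort <=%R (e `|` f)%fset in
  let first := if head 0%R u \in e then e else f in
  [seq z \in first | z <- u].

Definition is_clique (P : seq bool) (K : {fset {fset int}}) : Prop :=
  forall e f, e \in K -> f \in K -> e != f -> formed_pattern e f = P.

Record ordered_partition (r : nat) := OrderedPartition {
  parts :> seq nat;
  _ : all (leq 1) parts && (sumn parts == r) }.

HB.instance Definition _ (r : nat) := [isSub for @parts r].
HB.instance Definition _ (r : nat) := [Countable of ordered_partition r by <:].

Lemma size_le_sumn (l : seq nat) : all (leq 1) l -> size l <= sumn l.
Proof.
by elim: l => //= a l IHl /andP[a_gt0 /IHl l_le]; rewrite -add1n leq_add.
Qed.

Lemma mem_le_sumn (l : seq nat) (a : nat) : a \in l -> a <= sumn l.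
Proof.
elim: l => //= b l IHl; rewrite inE => /predU1P[->|/IHl al].
  exact: leq_addr.
by rewrite (leq_trans al) ?leq_addl.
Qed.

Lemma ordered_partition_size (r : nat) (l : ordered_partition r) :
  size [seq inord a : 'I_r.+1 | a <- l] <= r.
Proof.
by case: l => l /= /andP[l_gt0 /eqP <-]; rewrite size_map size_le_sumn.
Qed.

Definition bseq_of_ordered_partition (r : nat) (l : ordered_partition r) :
  r.-bseq 'I_r.+1 := Bseq (ordered_partition_size l).

Definition ordered_partition_of_bseq (r : nat) (b : r.-bseq 'I_r.+1) :
  option (ordered_partition r) := insub [seq val i | i <- b].

Lemma bseq_of_ordered_partitionK (r : nat) :
  pcancel (@bseq_of_ordered_partition r) (@ordered_partition_of_bseq r).
Proof.
move=> l; rewrite /ordered_partition_of_bseq /= -map_comp.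
rewrite (_ : map _ _ = val l) ?valK // map_id_in // => a al /=.
rewrite inordK // ltnS; case: l al => l /= lP al.
by have /andP[_ /eqP sl] := lP; rewrite -[leqRHS]sl mem_le_sumn.
Qed.

HB.instance Definition _ (r : nat) : isFinite (ordered_partition r) :=
  PCanIsFinite (@bseq_of_ordered_partitionK r).

(* [ds] lists, for each summand of [l], the summands into which it is split. *)
Definition splits (r : nat) (l l' : ordered_partition r) : Prop :=
  l != l' /\ exists ds : seq (seq nat),
    map sumn ds = parts l /\ flatten ds = parts l'.

(* The [i]-th entry of [c] is the member of the chain with [size l + i] parts;
   there are [r - size l + 1] entries, since [size l <= r]. *)
Definition is_chain (r : nat) (l : ordered_partition r)
    (c : (r - size l).+1.-tuple (ordered_partition r)) : Prop :=
  [/\ tnth c ord0 = l,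
      forall i, size (tnth c i) = size l + i &
      forall i j : 'I_(r - size l).+1, j = i.+1 :> nat ->
        splits (tnth c i) (tnth c j)].

Arguments is_chain {r} l c.

Definition patterns_of (r : nat) (l : ordered_partition r) :
    {set r.*2.-tuple bool} :=
  [set P : r.*2.-tuple bool | `[< is_pattern P /\ exists bs,
     block_partition P bs /\ map size bs = [seq a.*2 | a <- l] >]].

Definition is_partite (R : realType) (r : nat) (l : ordered_partition r)
    (H : {fset {fset int}}) : Prop :=
  exists x : nat -> R,
    [/\ forall i, i <= size l -> x i \isn't a Num.int,
        forall i, i < size l -> (x i < x i.+1)%R &
        forall e, e \in H -> forall i, i < size l ->
          #|` [fset z in e | (x i < z%:~R < x i.+1)%R]%fset| = nth 0 l i].

(* Main.v *)
(* Induction on [r - size l].  Each [P] in [patterns_of l] induces a strict partial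
   order on the family whose chains are [P]-cliques, so Mirsky's theorem, applied
   to these patterns one after the other, extracts a subfamily that is an
   antichain for all of them at the cost of the factor
   [\prod_(P in patterns_of l) m P].  Any two of its members [e], [f] then
   interleave inside some interval of the partition, so the least element there
   of one of them splits the other nontrivially.  For fixed [e], the members split
   at a fixed position [p] by such an element of [e] form a subfamily that is
   partite for the refinement of [l] at [p], and [e] itself belongs to one of
   these subfamilies.  Counting pairs bounds the antichain by twice the sum of the
   bounds for the one-step refinements of [l].  Unfolding this recursion gives the
   sum over chains; the products over different partitions combine because block
   partitions are unique. *)
Require Import Defs.
From mathcomp Require Import all_boot all_order all_algebra.
From mathcomp Require Import finmap boolp reals.
From mathcomp Require Import zify.

Set Implicit Arguments.
Unset Strict Implicit.
Unset Printing Implicit Defensive.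

Import Order.TTheory GRing.Theory Num.Theory.

(** * Finite sums and Mirsky's theorem *)

Lemma leq_sum_inj (I J : finType) (A : pred I) (B : pred J) (h : I -> J)
    (F : J -> nat) :
  {in A &, injective h} -> {in A, forall i, B (h i)} ->
  \sum_(i | A i) F (h i) <= \sum_(j | B j) F j.
Proof.
move=> h_inj hB; rewrite -(big_imset F (A := A)) //=.
rewrite [leqRHS](bigID [in h @: A]) /= [X in X <= _](_ : _ =
  \sum_(j | B j && (j \in h @: A)) F j) ?leq_addr //.
apply: eq_bigl => j; case: (boolP (j \in _)) => [/imsetP[i Ai ->]|].
  by rewrite hB.
by rewrite andbF.
Qed.

Local Open Scope fset_scope.

(** The order axioms are asked on [K] only, because the sign orders introduced below are proved
    strict only for sequences of the right length. *)
Lemma exists_minimal (T : choiceType) (lt : rel T) (K : {fset T}) :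
  {in K, irreflexive lt} -> {in K & &, transitive lt} -> K != fset0 ->
  exists2 x, x \in K & {in K, forall y, ~~ lt y x}.
Proof.
have [n] := ubnP #|` K|; elim: n => // n IHn in K *.
rewrite ltnS => leKn irr tr /fset0Pn[x xK].
pose K' := [fset y in K | lt y x].
have K'P y : (y \in K') = (y \in K) && lt y x by rewrite !inE.
have [K'0|K'n0] := eqVneq K' fset0.
  exists x => // y yK; apply/negP => yx.
  by have := K'P y; rewrite K'0 inE yK yx.
have sK : {subset K' <= K} by move=> y; rewrite K'P => /andP[].
have [||||y yK' ymin] := IHn K' => //.
- apply: leq_trans leKn; apply: fproper_ltn_card; rewrite fproperE.
  apply/andP; split; first exact/fsubsetP.
  by apply/fsubsetPn; exists x => //; rewrite K'P irr ?andbF.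
- by move=> y /sK /irr.
- by move=> y z t /sK ? /sK ? /sK ?; apply: tr.
exists y => [|z zK]; first exact: sK.
apply/negP => zy; have := yK'; rewrite K'P => /andP[yK yx].
have zK' : z \in K' by rewrite K'P zK (tr y).
by have := ymin z zK'; rewrite zy.
Qed.

Definition chain (T : eqType) (lt : rel T) (K : pred T) : Prop :=
  {in K &, forall x y, x != y -> lt x y || lt y x}.

Definition antichain (T : eqType) (lt : rel T) (A : pred T) : Prop :=
  {in A &, forall x y, ~~ lt x y}.

(* Mirsky: the minimal elements form an antichain whose removal shortens
   every longest chain. *)
Lemma large_antichain (T : choiceType) (lt : rel T) (m : nat) (H : {fset T}) :
  {in H, irreflexive lt} -> {in H & &, transitive lt} ->
  (forall K, K `<=` H -> chain lt [in K] -> #|` K| <= m) ->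
  exists A, [/\ A `<=` H, antichain lt [in A] & #|` H| <= m * #|` A|].
Proof.
elim: m H => [|m IHm] H irr tr chain_le.
  suff -> : H = fset0 by exists fset0; split=> //; rewrite cardfs0.
  apply/eqP/negPn/negP => /fset0Pn[x xH]; have := chain_le [fset x].
  rewrite fsub1set cardfs1 => /(_ xH) le10.
  suff /le10 : chain lt [in [fset x]] by [].
  by move=> a b /=; rewrite !inE => /eqP-> /eqP->; rewrite eqxx.
pose M := [fset x in H | ~~ has (lt^~ x) H].
have MP x : (x \in M) = (x \in H) && ~~ has (lt^~ x) H by rewrite !inE.
have MH : M `<=` H by apply/fsubsetP => x; rewrite MP => /andP[].
have anti_M : antichain lt [in M].
  move=> x y /=; rewrite !MP => /andP[xH _] /andP[yH /hasPn]; exact.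
have sD : {subset H `\` M <= H} by move=> x; rewrite inE => /andP[].
have [|||A [AHM anti_A leA]] := IHm (H `\` M).
- by move=> x /sD /irr.
- by move=> x y z /sD ? /sD ? /sD ?; apply: tr.
- move=> K KHM chK; have [->|K_n0] := eqVneq K fset0; first by rewrite cardfs0.
  have sK : {subset K <= H} by move=> x /(fsubsetP KHM)/sD.
  have [||x xK x_min] := @exists_minimal T lt K _ _ K_n0.
  + by move=> x /sK /irr.
  + by move=> x y z /sK ? /sK ? /sK ?; apply: tr.
  have xH := sK _ xK.
  (* A chain avoiding [M] can be prolonged: its least element [x] is not minimal in [H], so some [y]
     lies below [x] and hence below the whole chain. *)
  have /hasP[y yH yx] : has (lt^~ x) H.
    have := fsubsetP KHM _ xK.
    by rewrite in_fsetD MP xH /= negbK andbT.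
  have yK z : z \in K -> lt y z.
    move=> zK; have [<-//|nxz] := eqVneq x z.
    have /orP[xz|zx] := chK x z xK zK nxz; last by have := x_min z zK; rewrite zx.
    by apply: (tr x) => //; exact: sK.
  have ynK : y \notin K by apply/negP => /yK; rewrite irr.
  have := chain_le (y |` K); rewrite cardfsU1 ynK add1n ltnS; apply.
    by rewrite fsubUset fsub1set yH; apply/fsubsetP.
  move=> a b /=; rewrite !inE => /predU1P[->|aK] /predU1P[->|bK] //.
  + by rewrite eqxx.
  + by move=> _; rewrite yK.
  + by move=> _; rewrite (yK a) ?orbT.
  + exact: chK.
have HE : #|` H| = (#|` M| + #|` H `\` M|)%N.
  by rewrite -(cardfsID M H) (fsetIidPr MH).
(* The larger of [M] and [A] serves, since [H] has at most [#|] M| + m * #|[A|] elements. *)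
rewrite HE; have [leMA|/ltnW leAM] := leqP #|` M| #|` A|.
  exists A; split=> //; last by rewrite mulSn leq_add.
  by apply: fsubset_trans AHM _; apply: fsubsetDl.
exists M; split=> //; rewrite mulSn leq_add2l (leq_trans leA) //.
by rewrite leq_mul2l leAM orbT.
Qed.

(** Antichains and clique bounds pass to subfamilies, so the extraction can be repeated for each
    order in turn, and the factors multiply. *)
Lemma large_common_antichain (T : choiceType) (I : eqType) (lt : I -> rel T)
    (m : I -> nat) (s : seq I) (H : {fset T}) :
  {in s, forall i, [/\ {in H, irreflexive (lt i)}, {in H & &, transitive (lt i)}
    & forall K, K `<=` H -> chain (lt i) [in K] -> #|` K| <= m i]} ->
  exists A, [/\ A `<=` H, {in s, forall i, antichain (lt i) [in A]} &
    #|` H| <= (\prod_(i <- s) m i) * #|` A|].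
Proof.
elim: s H => [|i s IHs] H Hs.
  by exists H; split=> //; rewrite big_nil mul1n.
have [irr tr ch] := Hs i (mem_head _ _).
have [B [BH antiB leB]] := large_antichain irr tr ch.
have [|A [AB antiA leA]] := IHs B.
  move=> j js; have [|irrj trj chj] := Hs j; first by rewrite inE js orbT.
  split=> [x /(fsubsetP BH)/irrj//|x y z|K KB].
    by move=> /(fsubsetP BH)? /(fsubsetP BH)? /(fsubsetP BH)?; apply: trj.
  by apply: chj; apply: fsubset_trans BH.
exists A; split; first exact: fsubset_trans BH.
  move=> j; rewrite inE => /predU1P[->|]; last exact: antiA.
  by move=> x y /(fsubsetP AB)? /(fsubsetP AB)?; apply: antiB.
by rewrite big_cons -mulnA (leq_trans leB) // leq_mul2l leA orbT.
Qed.
Local Close Scope fset_scope.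

(** * Cut positions, splittings and signs for integer sequences *)

Fixpoint psums (l : seq nat) : seq nat :=
  if l is n :: l' then n :: map (addn n) (psums l') else [::].

(** For a cut [p] strictly inside a part, this is the index of the least element of that part. *)
Fixpoint part_start (l : seq nat) (p : nat) : nat :=
  if l is n :: l' then if p < n then 0 else n + part_start l' (p - n) else 0.

Fixpoint cut_part (p : nat) (l : seq nat) : seq nat :=
  if l is n :: l' then
    if p < n then [:: p, n - p & l'] else n :: cut_part (p - n) l'
  else [::].

Definition separated (u v : seq int) (d : nat) : bool :=
  allrel <%R (take d u) (drop d v).

(** The left inequality is weak so that [z] can split a sequence to which it belongs. *)
Definition splits_at (z : int) (v : seq int) (p : nat) : bool :=
  all (fun y => y <= z)%R (take p v) && all (fun y => z < y)%R (drop p v).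

Fixpoint sign_pattern (l : seq nat) (eps : seq bool) : seq bool :=
  match l, eps with
  | n :: l', b :: eps' => nseq n b ++ nseq n (~~ b) ++ sign_pattern l' eps'
  | _, _ => [::]
  end.

(** The first letter of each block, which determines a block of known length. *)
Fixpoint signs (l : seq nat) (P : seq bool) : seq bool :=
  if l is n :: l' then head true P :: signs l' (drop n.*2 P) else [::].

(** With [eps = signs l P] this is the order attached to a pattern [P]: a sign A puts the part of
    [u] first, a sign B that of [v]. *)
Fixpoint sign_lt (l : seq nat) (eps : seq bool) (u v : seq int) : bool :=
  match l, eps with
  | n :: l', b :: eps' =>
      (if b then allrel <%R (take n u) (take n v)
       else allrel <%R (take n v) (take n u)) &&
      sign_lt l' eps' (drop n u) (drop n v)
  | _, _ => true
  end.

(** An explicit form of the increasing enumeration of the union of [u] and [v], valid when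
    [sign_lt l eps u v] holds and the parts are separated; the formed pattern is read off from
    it. *)
Fixpoint sign_merge (l : seq nat) (eps : seq bool) (u v : seq int) : seq int :=
  match l, eps with
  | n :: l', b :: eps' =>
      (if b then take n u ++ take n v else take n v ++ take n u) ++
      sign_merge l' eps' (drop n u) (drop n v)
  | _, _ => [::]
  end.

(** * Strict orders and merged sequences given by signs *)

Lemma allrel_lt_trans (s t w : seq int) :
  0 < size t -> allrel <%R s t -> allrel <%R t w -> allrel <%R s w.
Proof.
case: t => // y t _ /allrelP st /allrelP tw; apply/allrelP => x z xs zw.
by apply: (lt_trans (st x y xs _) (tw y z _ zw)); rewrite mem_head.
Qed.

(** All parts are positive, so in each part the comparison passes through an element of [v]. *)
Lemma sign_lt_trans l eps u v w :
  all (leq 1) l -> size v = sumn l ->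
  sign_lt l eps u v -> sign_lt l eps v w -> sign_lt l eps u w.
Proof.
elim: l eps u v w => [|n l IHl] [|b eps] //= u v w /andP[n_gt0 l_gt0] sz_v.
have sz_t : 0 < size (take n v).
  by rewrite size_take_min sz_v; lia.
move=> /andP[uv luv] /andP[vw lvw]; apply/andP; split.
  by case: b uv vw => uv vw; [exact: allrel_lt_trans uv vw|
    exact: allrel_lt_trans vw uv].
by apply: IHl luv lvw => //; rewrite size_drop sz_v addKn.
Qed.

Lemma sign_lt_irr l eps u :
  0 < size l -> size eps = size l -> all (leq 1) l -> size u = sumn l ->
  sign_lt l eps u u = false.
Proof.
case: l eps => [|n l] [|b eps] //= _ _ /andP[n_gt0 _].
case: u => [|x u]; first by case: n n_gt0.
case: n n_gt0 => // n _ _ /=; rewrite if_same.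
by rewrite allrel_consl /= ltxx.
Qed.

Lemma sign_lt_negb l eps u v : sign_lt l (map negb eps) u v = sign_lt l eps v u.
Proof.
elim: l eps u v => [|n l IHl] [|b eps] //= u v; rewrite IHl.
by case: b.
Qed.

Lemma perm_sign_merge l eps u v :
  size eps = size l -> size u = sumn l -> size v = sumn l ->
  perm_eq (sign_merge l eps u v) (u ++ v).
Proof.
elim: l eps u v => [|n l IHl] [|b eps] //= u v.
  by move=> _ /size0nil-> /size0nil->.
move=> [sz_eps] sz_u sz_v.
have := IHl eps (drop n u) (drop n v) sz_eps.
rewrite !size_drop sz_u sz_v addKn => /(_ erefl erefl) pe.
rewrite -[X in perm_eq _ (X ++ _)](cat_take_drop n).
rewrite -[X in perm_eq _ (_ ++ X)](cat_take_drop n).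
rewrite (permPr (permEl (perm_catACA _ _ _ _))).
by apply: perm_cat => //; case: b => //; rewrite perm_catC.
Qed.

Lemma separated_drop n u v d :
  separated u v (n + d) -> separated (drop n u) (drop n v) d.
Proof.
rewrite /separated drop_drop [d + n]addnC => /allrelP sep; apply/allrelP => x y.
by move=> xu; apply: sep; rewrite takeD mem_cat xu orbT.
Qed.

(** Inside a part the sign decides which half comes first; separation at the partial sums keeps
    different parts in order. *)
Lemma sorted_sign_merge l eps u v :
  size eps = size l -> size u = sumn l -> size v = sumn l ->
  sorted <%R u -> sorted <%R v ->
  {in psums l, forall d, separated u v d && separated v u d} ->
  sign_lt l eps u v -> sorted <%R (sign_merge l eps u v).
Proof.
elim: l eps u v => [|n l IHl] [|b eps] //= u v.
move=> [sz_eps] sz_u sz_v su sv sep /andP[b_uv l_uv].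
have sz_du : size (drop n u) = sumn l by rewrite size_drop sz_u addKn.
have sz_dv : size (drop n v) = sumn l by rewrite size_drop sz_v addKn.
have sdu := drop_sorted n su; have sdv := drop_sorted n sv.
have ssep : sorted <%R (sign_merge l eps (drop n u) (drop n v)).
  apply: IHl => // d ld.
  have := sep (n + d); rewrite inE map_f ?orbT // => /(_ isT)/andP[].
  by move=> /separated_drop-> /separated_drop->.
have := sep n (mem_head _ _); rewrite /separated => /andP[sep1 sep2].
have halves (w : seq int) : sorted <%R w ->
    allrel <%R (take n w) (drop n w) /\ pairwise <%R (take n w).
  rewrite lt_sorted_pairwise -{1}[w](cat_take_drop n) pairwise_cat.
  by case/and3P.
have [uu pu] := halves u su; have [vv pv] := halves v sv.
rewrite lt_sorted_pairwise in ssep.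
rewrite lt_sorted_pairwise pairwise_cat ssep andbT.
rewrite (eq_allrel_memr _ _ (perm_mem (perm_sign_merge sz_eps sz_du sz_dv))).
rewrite !allrel_catr.
by case: b b_uv => uv; rewrite !allrel_catl pairwise_cat uv pu pv uu vv
  sep1 sep2.
Qed.

Lemma map_sign_merge l eps u v (a : pred int) :
  size u = sumn l -> size v = sumn l ->
  all a u -> all (predC a) v ->
  map a (sign_merge l eps u v) = sign_pattern l eps.
Proof.
elim: l eps u v => [|n l IHl] [|b eps] //= u v sz_u sz_v au av.
have map_nseq (c : bool) (w : seq int) :
    size w = n + sumn l -> all (fun x => a x == c) w ->
    map a (take n w) = nseq n c.
  move=> sz_w aw; have sz_t : size (take n w) = n.
    by rewrite size_takel // sz_w leq_addr.
  rewrite -[n in RHS]sz_t.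
  have : all (fun x => a x == c) (take n w).
    by apply/allP => x /mem_take/(allP aw).
  by elim: (take n w) => //= x t IHt /andP[/eqP-> /IHt->].
have t_u : map a (take n u) = nseq n true.
  by apply: map_nseq sz_u _; apply: sub_all au => x ->.
have t_v : map a (take n v) = nseq n false.
  by apply: map_nseq sz_v _; apply: sub_all av => x /negbTE->.
rewrite map_cat IHl ?size_drop ?sz_u ?sz_v ?addKn //.
- by case: b; rewrite map_cat t_u t_v -catA.
- by apply/allP => x /mem_drop/(allP au).
- by apply/allP => x /mem_drop/(allP av).
Qed.

(** * Collectable patterns coded by block lengths and signs *)

Lemma size_sign_pattern l eps :
  size eps = size l -> size (sign_pattern l eps) = (sumn l).*2.
Proof.
elim: l eps => [|n l IHl] [|b eps] //= [/IHl IH].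
by rewrite !size_cat !size_nseq IH doubleD addnA addnn.
Qed.

Lemma count_sign_pattern l eps c :
  size eps = size l -> count_mem c (sign_pattern l eps) = sumn l.
Proof.
elim: l eps => [|n l IHl] [|b eps] //= [/IHl IH].
rewrite !count_cat !count_nseq IH addnA; congr (_ + _).
by case: b; case: (c); rewrite /= ?mul1n ?mul0n ?addn0.
Qed.

Lemma size_signs l P : size (signs l P) = size l.
Proof. by elim: l P => //= n l IHl P; rewrite IHl. Qed.

Lemma sign_patternK l eps :
  size eps = size l -> all (leq 1) l -> signs l (sign_pattern l eps) = eps.
Proof.
elim: l eps => [|n l IHl] [|b eps] //= [sz_eps] /andP[n_gt0 l_gt0].
congr (_ :: _); first by case: n n_gt0.
by rewrite catA drop_size_cat ?IHl // size_cat !size_nseq addnn.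
Qed.

(* The common first length is where the first letter changes. *)
Lemma sign_pattern_inj l l' eps eps' :
  size eps = size l -> size eps' = size l' ->
  all (leq 1) l -> all (leq 1) l' ->
  sign_pattern l eps = sign_pattern l' eps' -> l = l'.
Proof.
have find_change n b s : 0 < n ->
    find (pred1 (~~ b)) (nseq n b ++ nseq n (~~ b) ++ s) = n.
  case: n => // n _; rewrite find_cat has_nseq size_nseq.
  by case: b => /=; rewrite addn0.
elim: l l' eps eps' => [|n l IHl] [|n' l'] [|b eps] [|b' eps'] //=.
- by move=> _ _ _ /andP[]; case: n'.
- by move=> _ _ /andP[]; case: n.
move=> [sz] [sz'] /andP[n_gt0 l_gt0] /andP[n'_gt0 l'_gt0] eq_pat.
have eq_b : b = b'.
  by have := congr1 (head true) eq_pat; case: (n) (n') n_gt0 n'_gt0 => [|?] [].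
have eq_n : n = n'.
  have := congr1 (find (pred1 (~~ b))) eq_pat.
  by rewrite find_change // eq_b find_change.
move: eq_pat; rewrite -eq_n -eq_b => /(congr1 (drop n.*2)).
have sz2 : size (nseq n b ++ nseq n (~~ b)) = n.*2.
  by rewrite size_cat !size_nseq addnn.
rewrite !catA !drop_size_cat // => /(IHl _ _ _ sz sz' l_gt0 l'_gt0) ->.
by [].
Qed.

Lemma block_partition_sign_pattern l P bs :
  all (leq 1) l -> block_partition P bs -> map size bs = map double l ->
  P = sign_pattern l (signs l P).
Proof.
elim: l bs P => [|n l IHl] [|b bs] // P; first by move=> _ [_ <-].
move=> /= /andP[n_gt0 l_gt0] [blk <-] [sz_b sz_bs] /=.
have [k [_ bE]] := blk b (mem_head _ _).
have kn : k = n.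
  apply: double_inj; rewrite -sz_b.
  by case: bE => ->; rewrite size_cat !size_nseq addnn.
rewrite drop_size_cat // -(IHl bs) //; last first.
  by split=> // c cbs; apply: blk; rewrite inE cbs orbT.
by case: (n) n_gt0 kn bE => // n' _ -> [->|->]; rewrite -catA.
Qed.

Lemma sign_pattern_block_partition l eps :
  size eps = size l -> all (leq 1) l ->
  exists bs, block_partition (sign_pattern l eps) bs /\
    map size bs = map double l.
Proof.
elim: l eps => [|n l IHl] [|b eps] //=; first by exists [::].
move=> [/IHl IH] /andP[n_gt0 /IH[bs [[blk fl] sz]]].
exists ((nseq n b ++ nseq n (~~ b)) :: bs); split; last first.
  by rewrite /= sz size_cat !size_nseq addnn.
split; last by rewrite /= fl catA.
move=> c; rewrite inE => /predU1P[->|/blk//].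
by exists n; split=> //; case: b; [left|right].
Qed.

(** * Splitting one sequence by an element of another *)

Lemma splits_at_find z (v : seq int) (p := find (fun y => z < y)%R v) :
  sorted <%R v -> splits_at z v p.
Proof.
move=> sv; apply/andP; split.
  apply/(all_nthP 0%R) => i; rewrite size_take_min ltn_min => /andP[ip _].
  by rewrite nth_take // leNgt (before_find 0%R ip).
apply/allP => y yd; have pv : p < size v.
  by rewrite ltnNge; apply/negP => /drop_oversize dE; rewrite dE in yd.
have zp : (z < nth 0 v p)%R by apply: nth_find; rewrite has_find.
move: yd; rewrite (drop_nth 0%R pv) inE => /predU1P[->//|yd].
apply: (lt_trans zp).
have := drop_sorted p sv; rewrite (drop_nth 0%R pv) lt_sorted_pairwise /=.
by move=> /andP[/allP/(_ y yd)].
Qed.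

Lemma part_start_lt l p : p < sumn l -> part_start l p < sumn l.
Proof.
elim: l p => //= n l IHl p p_lt; have [pn|np] := ltnP p n; first by lia.
by rewrite ltn_add2l IHl; lia.
Qed.

(* In a part where neither sequence precedes the other, the sequence with the
   larger least element splits the other one at that element. *)
Lemma interleave l (u v : seq int) :
  all (leq 1) l -> size u = sumn l -> size v = sumn l ->
  sorted <%R u -> sorted <%R v -> {in u & v, forall x y, x != y} ->
  {in psums l, forall d, separated u v d && separated v u d} ->
  (forall eps, size eps = size l -> ~~ sign_lt l eps u v) ->
  exists p, [/\ 0 < p < sumn l, p \notin psums l &
    splits_at (nth 0%R u (part_start l p)) v p ||
    splits_at (nth 0%R v (part_start l p)) u p].
Proof.
elim: l u v => [|n l IHl] u v; first by move=> _ _ _ _ _ _ _ /(_ [::] erefl).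
move=> /= /andP[n_gt0 l_gt0] sz_u sz_v su sv dis sep nlt.
have /andP[sep1 sep2] := sep n (mem_head _ _).
have n_lt_psum p : p < n -> p \notin n :: [seq n + d | d <- psums l].
  move=> pn; rewrite inE negb_or neq_ltn pn /=.
  by apply/mapP => -[k _ E]; move: pn; rewrite E; lia.
have aux (w t : seq int) : size w = n + sumn l -> size t = n + sumn l ->
    sorted <%R t -> {in w & t, forall x y, x != y} ->
    ~~ allrel <%R (take n t) (take n w) -> sorted <%R w ->
    (nth 0 t 0 < nth 0 w 0)%R ->
    exists p, [/\ 0 < p < n + sumn l,
      p \notin n :: [seq n + d | d <- psums l] &
      splits_at (nth 0%R w (part_start (n :: l) p)) t p].
  move=> sz_w sz_t st dwt ntw sw t0w0.
  set z := nth 0%R w 0; pose p := find (fun y => z < y)%R t.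
  have p_gt0 : 0 < p.
    case: t sz_t @p t0w0 {st dwt ntw} => [|y t] /=; first by lia.
    by rewrite -/z => _ yz; rewrite ltNge ltW.
  (* Otherwise the first part of [t] lies below the least element of [w], hence before the first
     part of [w], against the hypothesis. *)
  have p_lt : p < n.
    rewrite ltnNge; apply/negP => np; case/negP: ntw; apply/allrelP => x y xt yw.
    have : (x <= z)%R.
      have /andP[/allP le_z _] := splits_at_find z st.
      apply: le_z; rewrite -/p -(subnKC np) takeD mem_cat xt //.
    have zy : (z <= y)%R.
      move: yw sw; rewrite /z; case: w {sz_w dwt t0w0 z p p_gt0 np} => //= c w.
      move=> /mem_take; rewrite inE => /predU1P[->//|yw].
      rewrite lt_path_sortedE => /andP[/allP/(_ y yw) cy _]; exact: ltW.
    move=> xz; rewrite lt_neqAle (le_trans xz zy) andbT eq_sym.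
    by apply: dwt; [exact: mem_take yw|exact: mem_take xt].
  exists p; split; [by lia|exact: n_lt_psum|].
  by rewrite /= p_lt; apply: splits_at_find.
(* If the first parts are comparable, their order is recorded as the sign [b]; the remaining parts
   then satisfy the hypotheses, and the position found there is shifted by [n]. *)
have rec b : (if b then allrel <%R (take n u) (take n v)
    else allrel <%R (take n v) (take n u)) ->
    exists p, [/\ 0 < p < n + sumn l,
      p \notin n :: [seq n + d | d <- psums l] &
      splits_at (nth 0%R u (part_start (n :: l) p)) v p ||
      splits_at (nth 0%R v (part_start (n :: l) p)) u p].
  move=> b_uv; have [||||||||p [p_bd p_psums p_split]] :=
    IHl (drop n u) (drop n v).
  - by [].
  - by rewrite size_drop sz_u addKn.
  - by rewrite size_drop sz_v addKn.
  - exact: drop_sorted.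
  - exact: drop_sorted.
  - by move=> x y /mem_drop xu /mem_drop; apply: dis.
  - move=> d ld; have := sep (n + d).
    rewrite inE map_f ?orbT // => /(_ isT)/andP[].
    by move=> /separated_drop-> /separated_drop->.
  - move=> eps sz_eps; have := nlt (b :: eps).
    by rewrite /= sz_eps b_uv => /(_ erefl).
  have np_ge : n + p < n = false by lia.
  exists (n + p); split; first by lia.
    rewrite inE negb_or mem_map ?p_psums ?andbT; last exact: addnI.
    by apply/eqP; lia.
  rewrite /= np_ge addKn -!nth_drop.
  have ext (w t : seq int) : size w = n + sumn l -> size t = n + sumn l ->
      separated t w n ->
      splits_at (nth 0%R (drop n w) (part_start l p)) (drop n t) p ->
      splits_at (nth 0%R (drop n w) (part_start l p)) t (n + p).
    move=> sz_w sz_t /allrelP sep_tw /andP[t_le t_gt].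
    rewrite /splits_at takeD all_cat t_le andbT addnC -drop_drop t_gt andbT.
    apply/allP => y yt; apply/ltW/sep_tw => //; apply: mem_nth.
    by rewrite size_drop sz_w addKn part_start_lt //; case/andP: p_bd.
  by case/orP: p_split => /ext->; rewrite ?orbT.
have [uv|nuv] := boolP (allrel <%R (take n u) (take n v)).
  exact: (rec true).
have [vu|nvu] := boolP (allrel <%R (take n v) (take n u)).
  exact: (rec false).
have u0u : nth 0%R u 0 \in u by rewrite mem_nth // sz_u addn_gt0 n_gt0.
have v0v : nth 0%R v 0 \in v by rewrite mem_nth // sz_v addn_gt0 n_gt0.
have := dis _ _ u0u v0v; rewrite neq_lt => /orP[lt0|lt0].
  have [|p [bd np spl]] := aux v u sz_v sz_u su _ nuv sv lt0.
    by move=> x y xv yu; rewrite eq_sym dis.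
  by exists p; rewrite bd np [X in _ || X]spl orbT.
have [p [bd np spl]] := aux u v sz_u sz_v sv dis nvu su lt0.
by exists p; rewrite bd np [X in X || _]spl.
Qed.

(** Some part has at least two elements; the cut right after its least element works. This supplies
    the diagonal pairs in the double counting. *)
Lemma splits_at_start l (u : seq int) :
  all (leq 1) l -> size l < sumn l -> size u = sumn l -> sorted <%R u ->
  exists p, [/\ 0 < p < sumn l, p \notin psums l &
    splits_at (nth 0%R u (part_start l p)) u p].
Proof.
move=> l_gt0 sz_l sz_u su.
have [p [bd np st]] : exists p, [/\ 0 < p < sumn l, p \notin psums l &
    p = (part_start l p).+1].
  elim: l l_gt0 sz_l {sz_u} => //= n l IHl /andP[n_gt0 l_gt0] lt_sz.
  have [n1|n1] := leqP n 1.
    have nE : n = 1 by lia.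
    rewrite nE in lt_sz *; have [|p [bd np st]] := IHl l_gt0; first by lia.
    exists p.+1; split; first by lia.
      rewrite inE negb_or -add1n mem_map ?np ?andbT; last exact: addnI.
      by apply/eqP; lia.
    by rewrite ltnS ltn0 subSS subn0 /= add1n -st //; case/andP: bd; case: (p).
  exists 1; split; [by lia| |by rewrite n1].
  rewrite inE negb_or neq_ltn n1 /=.
  by apply/mapP => -[k _ E]; lia.
exists p; split=> //; set z := nth _ _ _.
have p_sz : part_start l p < size u by rewrite sz_u part_start_lt //; case/andP: bd.
apply/andP; split; apply/(all_nthP 0%R) => i.
  rewrite size_take_min ltn_min => /andP[ip i_sz]; rewrite nth_take //.
  by rewrite (lt_sorted_leq_nth 0%R su) ?inE // -ltnS -st.
rewrite size_drop nth_drop ltn_subRL => i_sz.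
have sp : part_start l p < p by rewrite [ltnRHS]st.
by rewrite (lt_sorted_ltn_nth 0%R su) ?inE // (leq_trans sp) ?leq_addr.
Qed.

(** * Cutting a part in two *)

Lemma cut_partP p l :
  0 < p < sumn l -> p \notin psums l -> all (leq 1) l ->
  [/\ all (leq 1) (cut_part p l), sumn (cut_part p l) = sumn l,
    size (cut_part p l) = (size l).+1,
    psums (cut_part p l) =i p :: psums l &
    exists ds, map sumn ds = l /\ flatten ds = cut_part p l].
Proof.
elim: l p => [|n l IHl] p /=; first by rewrite ltn0 andbF.
move=> p_bd; rewrite inE negb_or => /andP[pn p_psums] /andP[n_gt0 l_gt0].
case: ltnP => [p_lt|p_ge].
  split=> /=; [by rewrite l_gt0; lia|by lia|by []| |].
    rewrite subnKC; last exact: ltnW.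
    have addE : addn p \o addn (n - p) =1 addn n.
      by move=> k; rewrite /= addnA subnKC // ltnW.
    by rewrite -map_comp (eq_map addE).
  exists ([:: p; n - p] :: [seq [:: k] | k <- l]); split.
    have sum1 : sumn \o (fun k => [:: k]) =1 id by move=> k; rewrite /= addn0.
    by rewrite /= -map_comp (eq_map sum1) map_id addn0 subnKC // ltnW.
  by rewrite /= flatten_map1 map_id.
have pE : p = n + (p - n) by rewrite subnKC.
have [||c_gt0 c_sum c_sz c_ps [ds [dsl dsc]]] := IHl (p - n) _ _ l_gt0.
- by lia.
- by apply: contra p_psums => ps; rewrite pE map_f.
split=> /=; [by rewrite n_gt0|by rewrite c_sum|by rewrite c_sz| |].
  move=> d; rewrite !inE orbCA; congr (_ || _).
  rewrite (eq_mem_map _ c_ps) /= inE -pE //.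
by exists ([:: n] :: ds); rewrite /= addn0 dsl dsc.
Qed.

(** * Counting ordered pairs *)

(** Summing over all ordered pairs bounds the square of the cardinality by [2 * S] times the
    cardinality. The diagonal pairs are included, which gives [2 * S] and not [2 * S + 1]. *)
Lemma double_counting (T : choiceType) (A : {fset T}) (t : T -> T -> nat) S :
  {in A &, forall x y, 0 < t x y + t y x} ->
  {in A, forall x, \sum_(y <- A) t x y <= S} -> #|` A| <= 2 * S.
Proof.
move=> t_gt0 t_le.
have [->|A_n0] := eqVneq A fset0; first by rewrite cardfs0.
have A_gt0 : 0 < #|` A| by rewrite cardfs_gt0.
have sum_cst c : \sum_(x <- A) c = c * #|` A|.
  by rewrite big_const_seq count_predT iter_addn_0.
have pairs : #|` A| * #|` A| <= \sum_(x <- A) \sum_(y <- A) (t x y + t y x).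
  rewrite -[X in X * _]mul1n -sum_cst -sum_cst big_seq [leqRHS]big_seq.
  apply: leq_sum => x xA; rewrite big_seq [leqRHS]big_seq.
  by apply: leq_sum => y yA; apply: t_gt0.
have sum_t : \sum_(x <- A) \sum_(y <- A) t x y <= S * #|` A|.
  by rewrite -sum_cst big_seq [leqRHS]big_seq; apply: leq_sum.
rewrite -(leq_pmul2r A_gt0) (leq_trans pairs) //.
under eq_bigr do rewrite big_split.
by rewrite big_split /= [X in _ + X]exchange_big /= addnn -mul2n -mulnA leq_mul2l.
Qed.

(** * From sets of integers to increasing sequences and patterns *)

Definition increasing_seq (e : {fset int}) : seq int := sort <=%R e.

Lemma size_increasing_seq e : size (increasing_seq e) = #|` e|.
Proof. by rewrite size_sort. Qed.

Lemma mem_increasing_seq e x : (x \in increasing_seq e) = (x \in e).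
Proof. by rewrite mem_sort. Qed.

Lemma sorted_increasing_seq e : sorted <%R (increasing_seq e).
Proof. by rewrite sort_lt_sorted fset_uniq. Qed.

(** The first sign is A, so the least element of the union lies in [e]; thus [e] receives the letter
    A whichever of the two sets is listed first. *)
Lemma formed_patternE l eps (e f : {fset int}) :
  all (leq 1) l -> 0 < size l -> size eps = size l -> head true eps ->
  #|` e| = sumn l -> #|` f| = sumn l -> [disjoint e & f]%fset ->
  {in psums l, forall d, separated (increasing_seq e) (increasing_seq f) d &&
    separated (increasing_seq f) (increasing_seq e) d} ->
  sign_lt l eps (increasing_seq e) (increasing_seq f) ->
  formed_pattern e f = sign_pattern l eps /\
  formed_pattern f e = sign_pattern l eps.
Proof.
rewrite -!size_increasing_seq => l_gt0 sz_l sz_eps eps0 sz_e sz_f dis sep lt_ef.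
set u := increasing_seq e in lt_ef sz_e sep *.
set v := increasing_seq f in lt_ef sz_f sep *.
have perm_uv := perm_sign_merge sz_eps sz_e sz_f.
have sort_ef : sort <=%R (e `|` f)%fset = sign_merge l eps u v.
  apply: lt_sorted_eq; first by rewrite sort_lt_sorted fset_uniq.
    by apply: sorted_sign_merge => //; apply: sorted_increasing_seq.
  move=> x; rewrite (perm_mem perm_uv) mem_cat mem_sort in_fsetU.
  by rewrite !mem_increasing_seq.
have head_e : head 0%R (sign_merge l eps u v) \in e.
  rewrite -mem_increasing_seq -/u.
  case: (l) (eps) sz_l l_gt0 eps0 sz_eps sz_e => //= n l' [|b eps'] //= _.
  move=> /andP[n_gt0 _] -> _ sz_u.
  case: (u) sz_u => [|x w] /= sz_u; first by case: (n) n_gt0 sz_u.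
  by case: (n) n_gt0 => //= n' _; rewrite mem_head.
have head_f : head 0%R (sign_merge l eps u v) \notin f.
  by apply: (fdisjointP dis).
have mapE : map (mem e) (sign_merge l eps u v) = sign_pattern l eps.
  apply: map_sign_merge => //; apply/allP => x; rewrite mem_increasing_seq //.
  by move=> xf /=; apply: contraL xf; apply: (fdisjointP dis).
split; first by rewrite /formed_pattern sort_ef head_e.
by rewrite /formed_pattern fsetUC sort_ef (negbTE head_f).
Qed.

(** * Ordered partitions, their patterns and their one-step refinements *)

Lemma parts_gt0 r (l : ordered_partition r) : all (leq 1) l.
Proof. by case: l => l /= /andP[]. Qed.

Lemma sumn_parts r (l : ordered_partition r) : sumn l = r.
Proof. by case: l => l /= /andP[_ /eqP]. Qed.

Lemma patterns_ofP r (l : ordered_partition r) (P : r.*2.-tuple bool) :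
  P \in patterns_of l ->
  [/\ collectable P, head true P & tval P = sign_pattern l (signs l P)].
Proof.
rewrite inE => /asboolP[isP [bs [bsP szP]]].
split; first by split=> //; exists bs.
  by case: isP; case: (tval P) => // b s [->].
exact: block_partition_sign_pattern (parts_gt0 l) bsP szP.
Qed.

Lemma sign_pattern_mem r (l : ordered_partition r) eps :
  0 < size l -> size eps = size l -> head true eps ->
  exists2 P, P \in patterns_of l & tval P = sign_pattern l eps.
Proof.
move=> sz_l sz_eps eps0.
have sz : size (sign_pattern l eps) == r.*2.
  by rewrite size_sign_pattern // sumn_parts.
exists (Tuple sz) => //; rewrite inE; apply/asboolP; split; last first.
  exact: sign_pattern_block_partition sz_eps (parts_gt0 l).
split=> /=; rewrite ?count_sign_pattern ?sumn_parts //.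
case: (l : seq nat) (eps) (parts_gt0 l) sz_l sz_eps eps0 => // n l' [|b eps'] //=.
by case: n => // n _ _ _ ->.
Qed.

Lemma patterns_of_disjoint r (l l' : ordered_partition r) :
  l != l' -> [disjoint patterns_of l & patterns_of l'].
Proof.
apply: contraNT => /pred0Pn[P /andP[/patterns_ofP[_ _ lP] /patterns_ofP[_ _ l'P]]].
apply/eqP/val_inj; apply: (@sign_pattern_inj l l' (signs l P) (signs l' P)).
- exact: size_signs.
- exact: size_signs.
- exact: parts_gt0.
- exact: parts_gt0.
- by rewrite -lP -l'P.
Qed.

Definition covers r (l l' : ordered_partition r) : bool :=
  `[< splits l l' >] && (size l' == (size l).+1).

(** The default [l] is returned if the cut list is not an ordered partition of [r]; the cuts used
    below lie strictly inside a part. *)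
Definition refine r (l : ordered_partition r) (p : nat) : ordered_partition r :=
  insubd l (cut_part p l).

Lemma refineP r (l : ordered_partition r) p :
  0 < p < r -> p \notin psums l ->
  covers l (refine l p) /\ psums (refine l p) =i p :: psums l.
Proof.
move=> p_bd p_ps.
have [||c_gt0 c_sum c_sz c_ps c_ds] := @cut_partP p l _ p_ps.
- by rewrite sumn_parts.
- exact: parts_gt0.
have refE : parts (refine l p) = cut_part p l.
  by rewrite -[LHS]/(val _) val_insubd c_gt0 c_sum sumn_parts eqxx.
split; last by rewrite refE.
rewrite /covers refE c_sz eqxx andbT; apply/asboolP; split.
  by apply/eqP => /(congr1 (size \o @parts r)) /=; rewrite refE c_sz; lia.
by rewrite refE.
Qed.

(** * The recursive bound *)

(** [n] counts the refinement steps left; a family is bounded by it when [r = size l + n], so that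
    the recursion ends with all parts equal to 1. *)
Fixpoint iterated_bound r (m : r.*2.-tuple bool -> nat) (n : nat)
    (l : ordered_partition r) : nat :=
  (\prod_(P in patterns_of l) m P) *
  if n is n'.+1 then 2 * \sum_(l' | covers l l') iterated_bound m n' l' else 1.

(* [l]-partiteness in pairwise form: a cut of the whole family after [d] elements
   exists as soon as the [d] least elements of each member precede the other
   elements of each member. *)
Definition separated_matching r (l : ordered_partition r)
    (H : {fset {fset int}}) : Prop :=
  [/\ {in H, forall e, #|` e| = r},
      {in H &, forall e f, e != f -> [disjoint e & f]%fset} &
      {in psums l, forall d, {in H &, forall e f,
        separated (increasing_seq e) (increasing_seq f) d}}].

Definition cliques_bounded r (m : r.*2.-tuple bool -> nat)
    (H : {fset {fset int}}) : Prop :=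
  forall P, collectable P -> forall K, (K `<=` H)%fset -> is_clique P K ->
    #|` K| <= m P.

(** In a common antichain for the orders of all patterns in [patterns_of l], no choice of signs
    compares two distinct members, so [interleave] applies to them. *)
Lemma large_interleaving r (m : r.*2.-tuple bool -> nat)
    (l : ordered_partition r) (H : {fset {fset int}}) :
  0 < r -> separated_matching l H -> cliques_bounded m H ->
  exists A : {fset {fset int}}, [/\ (A `<=` H)%fset,
    {in A &, forall e f, e != f -> exists p, [/\ 0 < p < r, p \notin psums l &
      splits_at (nth 0%R (increasing_seq e) (part_start l p)) (increasing_seq f) p ||
      splits_at (nth 0%R (increasing_seq f) (part_start l p)) (increasing_seq e) p]} &
    #|` H| <= (\prod_(P in patterns_of l) m P) * #|` A|].
Proof.
move=> r_gt0 [cardH disH sepH] cliqueH.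
have sz_l : 0 < size l.
  by case: (l : seq nat) (sumn_parts l) => //= r0; rewrite -r0 in r_gt0.
pose lt (P : r.*2.-tuple bool) (e f : {fset int}) :=
  sign_lt l (signs l P) (increasing_seq e) (increasing_seq f).
have sz e : e \in H -> size (increasing_seq e) = sumn l.
  by move=> eH; rewrite size_increasing_seq cardH // sumn_parts.
have sep2 e f : e \in H -> f \in H -> {in psums l, forall d,
    separated (increasing_seq e) (increasing_seq f) d &&
    separated (increasing_seq f) (increasing_seq e) d}.
  by move=> eH fH d dl; rewrite !sepH.
have [|A [/fsubsetP AH antiA leA]] :=
    @large_common_antichain _ _ lt m (enum (patterns_of l)) H.
  move=> P; rewrite mem_enum => /patterns_ofP[colP headP PE].
  split=> [e eH|f e g fH eH gH|K KH chK].
  - by rewrite /lt sign_lt_irr ?size_signs ?parts_gt0 ?sz.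
  - by apply: sign_lt_trans; rewrite ?parts_gt0 ?sz.
  (* Members of a chain are comparable in one direction or the other, and either direction gives the
     pattern [P]. *)
  apply: cliqueH => // e f eK fK nef.
  have eH := fsubsetP KH e eK; have fH := fsubsetP KH f fK.
  have signs0 : head true (signs l P).
    by case: (l : seq nat) sz_l => //= n l' _; rewrite headP.
  rewrite PE; have /orP[lt_ef|lt_fe] := chK e f eK fK nef.
    have [] // := @formed_patternE l (signs l P) e f; rewrite ?parts_gt0 //.
    - exact: size_signs.
    - by rewrite cardH ?sumn_parts.
    - by rewrite cardH ?sumn_parts.
    - exact: disH.
    - exact: sep2.
  have [] // := @formed_patternE l (signs l P) f e; rewrite ?parts_gt0 //.
  - exact: size_signs.
  - by rewrite cardH ?sumn_parts.
  - by rewrite cardH ?sumn_parts.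
  - by apply: disH; rewrite // eq_sym.
  - exact: sep2.
exists A; split; [exact/fsubsetP| |by rewrite big_enum in leA].
move=> e f eA fA nef; have eH := AH e eA; have fH := AH f fA.
suff [p [p_bd ? ?]] : exists p, [/\ 0 < p < sumn l, p \notin psums l &
      splits_at (nth 0%R (increasing_seq e) (part_start l p)) (increasing_seq f) p ||
      splits_at (nth 0%R (increasing_seq f) (part_start l p)) (increasing_seq e) p].
  by exists p; split=> //; rewrite sumn_parts in p_bd.
apply: interleave; rewrite ?sz ?sorted_increasing_seq ?parts_gt0 //.
- move=> x y; rewrite !mem_increasing_seq => xe yf; apply: contraTneq yf => <-.
  exact: (fdisjointP (disH e f eH fH nef)).
- exact: sep2.
move=> eps sz_eps; apply/negP => lt_ef.
(* Patterns start with A, while [interleave] allows all signs; exchanging [e] and [f] negates every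
   sign. *)
wlog eps0 : e f eps sz_eps {nef} eA fA eH fH lt_ef / head true eps.
  move=> hyp; have [eps0|neps0] := boolP (head true eps).
    by apply: (hyp e f eps).
  apply: (hyp f e (map negb eps)); rewrite ?size_map ?sign_lt_negb //.
  by case: (eps) neps0.
have [P Pl PE] := sign_pattern_mem sz_l sz_eps eps0.
have := antiA P; rewrite mem_enum => /(_ Pl e f eA fA).
by rewrite /lt PE sign_patternK ?parts_gt0 // lt_ef.
Qed.

Lemma card_le_iterated_bound r (m : r.*2.-tuple bool -> nat) n
    (l : ordered_partition r) (H : {fset {fset int}}) :
  0 < r -> r = size l + n -> separated_matching l H -> cliques_bounded m H ->
  #|` H| <= iterated_bound m n l.
Proof.
move=> r_gt0; elim: n l H => [|n IHn] l H rE sepH cliqueH.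
  have [A [_ splitA leA]] := large_interleaving r_gt0 sepH cliqueH.
  rewrite /= (leq_trans leA) // leq_mul2l; apply/orP; right.
  have [->|/fset0Pn[e eA]] := eqVneq A fset0; first by rewrite cardfs0.
  rewrite -[leqRHS](cardfs1 e); apply/fsubset_leq_card/fsubsetP => f fA.
  rewrite inE; apply/negPn/negP => nfe.
  have [p [p_bd p_ps _]] := splitA f e fA eA nfe.
  (* Here [l] already has [r] parts, so a refinement would have [r + 1] positive parts of sum [r].
     Hence [A] has at most one member. *)
  have [/andP[_ /eqP sz] _] := refineP p_bd p_ps.
  have := size_le_sumn (parts_gt0 (refine l p)).
  by rewrite sumn_parts sz [leqRHS]rE addn0 ltnn.
have [A [/fsubsetP AH splitA leA]] := large_interleaving r_gt0 sepH cliqueH.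
rewrite /= (leq_trans leA) // leq_mul2l; apply/orP; right.
have [cardH disH sep] := sepH.
pose good (p : 'I_r) := (0 < p) && (val p \notin psums l).
pose t (p : 'I_r) (e f : {fset int}) :=
  splits_at (nth 0%R (increasing_seq e) (part_start l p)) (increasing_seq f) p.
apply: (@double_counting _ A (fun e f => \sum_(p | good p) t p e f)).
  move=> e f eA fA; have [p gp tp] : exists2 p, good p & t p e f || t p f e.
    (* On the diagonal, [e] is split by one of its own elements, as [size l < r]. *)
    have [<-|nef] := eqVneq e f.
      have [||||p [p_bd p_ps tp]] := @splits_at_start l (increasing_seq e).
      - exact: parts_gt0.
      - by rewrite sumn_parts [ltnRHS]rE addnS ltnS leq_addr.
      - by rewrite size_increasing_seq cardH ?AH // sumn_parts.
      - exact: sorted_increasing_seq.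
      move: p_bd; rewrite sumn_parts => /andP[p_gt0 p_r].
      by exists (Ordinal p_r); rewrite /good /t /= ?p_gt0 // tp.
    have [p [/andP[p_gt0 p_r] p_ps tp]] := splitA e f eA fA nef.
    by exists (Ordinal p_r); rewrite /good /t /= ?p_gt0.
  rewrite !(bigD1 p gp) /=.
  by case/orP: tp => ->; rewrite ?addn_gt0 ?orbT.
move=> e eA; rewrite exchange_big /=.
pose F (p : 'I_r) := [fset f in A | t p e f]%fset.
apply: (@leq_trans (\sum_(p : 'I_r | good p) iterated_bound m n (refine l p))).
  apply: leq_sum => p /andP[p_gt0 p_ps].
  have p_bd : 0 < p < r by rewrite p_gt0 ltn_ord.
  have [/andP[_ /eqP sz] ps] := refineP p_bd p_ps.
  have FP f : (f \in F p) = (f \in A) && t p e f by rewrite !inE.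
  have FH f : f \in F p -> f \in H by rewrite FP => /andP[/AH].
  have -> : \sum_(f <- A) t p e f = #|` F p|.
    transitivity (size (filter (t p e) A)).
      by rewrite size_filter -sum1_count [RHS]big_mkcond; apply: eq_bigr.
    apply/perm_size/uniq_perm; rewrite ?filter_uniq ?fset_uniq // => f.
    by rewrite FP mem_filter andbC.
  apply: IHn; first by rewrite sz [LHS]rE addnS.
    split=> [f /FH|f g /FH fH /FH gH|d]; [exact: cardH|exact: disH|].
    rewrite ps inE => /predU1P[->|dl] f g; last first.
      by move=> /FH fH /FH gH; apply: sep.
    (* At the new cut [p], one and the same element of [e] bounds the first [p] elements of [f] from
       above and lies strictly below the remaining elements of [g]. *)
    rewrite !FP => /andP[_ /andP[/allP f_le _]] /andP[_ /andP[_ /allP g_gt]].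
    by apply/allrelP => x y /f_le xz /g_gt; apply: le_lt_trans.
  move=> P colP K KF; apply: cliqueH => //; apply: (fsubset_trans KF).
  by apply/fsubsetP => f /FH.
(* A refinement determines its cut: [p] is its only partial sum that is not one of [l]. *)
apply: (leq_sum_inj (h := fun p : 'I_r => refine l p) (B := covers l)
  (iterated_bound m n)).
  move=> p q /andP[p_gt0 p_ps] /andP[q_gt0 q_ps] eq_pq; apply/val_inj.
  have [_ ps] := @refineP _ l p (introT andP (conj p_gt0 (ltn_ord p))) p_ps.
  have [_ qs] := @refineP _ l q (introT andP (conj q_gt0 (ltn_ord q))) q_ps.
  have : val p \in psums (refine l q) by rewrite -eq_pq ps mem_head.
  by rewrite qs inE (negbTE p_ps) orbF => /eqP.
move=> p /andP[p_gt0 p_ps].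
by have [] := @refineP _ l p (introT andP (conj p_gt0 (ltn_ord p))) p_ps.
Qed.

(** * Unfolding the recursion into a sum over chains *)

(** This is [is_chain] with the length freed from [r - size l], so that induction on [n] is
    possible. *)
Definition chain_seq r n (l : ordered_partition r)
    (c : n.+1.-tuple (ordered_partition r)) : Prop :=
  [/\ tnth c ord0 = l, forall i, size (tnth c i) = size l + i &
      forall i j : 'I_n.+1, j = i.+1 :> nat -> splits (tnth c i) (tnth c j)].

Lemma chain_seq_cons r n (l l' : ordered_partition r)
    (c : n.+1.-tuple (ordered_partition r)) :
  covers l l' -> chain_seq l' c -> chain_seq l [tuple of l :: c].
Proof.
move=> /andP[/asboolP l_l' /eqP sz_l'] [c0 c_sz c_split]; split=> //.
- move=> i; case: (unliftP ord0 i) => [j ->|->]; last by rewrite addn0.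
  by rewrite tnthS c_sz sz_l' /= /bump /= addSnnS.
- move=> i j; case: (unliftP ord0 j) => [j' ->|-> //].
  case: (unliftP ord0 i) => [i' ->|->] /=; rewrite /bump /= !add1n => -[ij].
    by rewrite !tnthS; apply: c_split.
  by rewrite tnthS (_ : j' = ord0) ?c0 //; apply: val_inj.
Qed.

(** Prepending [l] to the chains that start at its covers gives chains that start at [l]; each step
    contributes one factor 2. *)
Lemma iterated_bound_le r (m : r.*2.-tuple bool -> nat) n
    (l : ordered_partition r) :
  iterated_bound m n l <= 2 ^ n *
    \sum_(c : n.+1.-tuple (ordered_partition r) | `[< chain_seq l c >])
      \prod_(P in \bigcup_(k <- c) patterns_of k) m P.
Proof.
elim: n l => [|n IHn] l /=.
  have ch : `[< chain_seq l [tuple l] >].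
    by apply/asboolP; split=> // [i|i j]; rewrite !ord1 ?addn0.
  rewrite muln1 mul1n (bigD1 [tuple l]) //= big_seq1; exact: leq_addr.
pose G (c : n.+2.-tuple (ordered_partition r)) :=
  \prod_(P in \bigcup_(k <- c) patterns_of k) m P.
pose h (x : ordered_partition r * n.+1.-tuple (ordered_partition r)) :=
  [tuple of l :: x.2].
pose good (x : ordered_partition r * n.+1.-tuple (ordered_partition r)) :=
  covers l x.1 && `[< chain_seq x.1 x.2 >].
apply: (@leq_trans (2 ^ n.+1 * \sum_(x | good x) G (h x))); last first.
  rewrite leq_mul2l expn_eq0 /=.
  apply: (leq_sum_inj (B := fun c => `[< chain_seq l c >]) G).
    (* The first component of a good pair is the first entry of its chain, so the prolonged chain
       determines the pair. *)
    move=> [l1 c1] [l2 c2] /andP[/= _ /asboolP[<- _ _]] /andP[/= _ /asboolP[<- _ _]].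
    by move=> /(congr1 (@tval _ _))/= [/val_inj ->].
  by move=> [l' c] /andP[/= ll' /asboolP ch]; apply/asboolP/(chain_seq_cons ll').
rewrite mulnCA expnS -mulnA leq_mul2l /=.
rewrite /good -(pair_big_dep (covers l)
  (fun l' c => `[< chain_seq l' c >]) (fun l' c => G (h (l', c)))) /=.
rewrite !big_distrr /=; apply: leq_sum => l' ll'.
apply: (leq_trans (leq_mul (leqnn _) (IHn l'))).
rewrite mulnCA leq_mul2l; apply/orP; right.
rewrite big_distrr /=; apply: leq_sum => c /asboolP[c0 c_sz _].
(* Every later partition has more parts than [l], so it differs from [l] and shares no pattern with
   it; the product over the union therefore factors. *)
have disj : [disjoint \bigcup_(k <- c) patterns_of k & patterns_of l].
  rewrite big_seq; elim/big_ind: _ => [|B C|k /tnthP[i kE]].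
  - by rewrite -setI_eq0 set0I.
  - by rewrite -!setI_eq0 setIUl setU_eq0 => -> ->.
  apply: patterns_of_disjoint; apply/eqP => kl.
  have := c_sz i; rewrite -kE kl; case/andP: ll' => _ /eqP->; lia.
rewrite /G /h /= big_cons [leqRHS](big_setID (patterns_of l)) /= setUK.
by rewrite setDUl setDv set0U (setDidPl disj).
Qed.

(** * From real cut points to separation *)

Lemma mem_psums l d :
  d \in psums l -> exists2 i, i < size l & d = sumn (take i.+1 l).
Proof.
elim: l d => //= n l IHl d; rewrite inE => /predU1P[->|/mapP[k /IHl[i il ->] ->]].
  by exists 0; rewrite //= take0 addn0.
by exists i.+1.
Qed.

Lemma take_count_downward (a : pred int) (u : seq int) :
  sorted <%R u -> (forall x y, (x <= y)%R -> a y -> a x) ->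
  all a (take (count a u) u) && all (predC a) (drop (count a u) u).
Proof.
move=> su a_down; elim: u su => //= x u IHu xu.
have := xu; rewrite lt_path_sortedE => /andP[/allP x_lt su].
have [ax|nax] := boolP (a x); first by rewrite /= ax; apply: IHu.
have nau y : y \in u -> ~~ a y.
  by move=> yu; apply: contraNN nax; apply: a_down; apply/ltW/x_lt.
have -> : count a u = 0.
  by apply/eqP; rewrite -leqn0 leqNgt -has_count; apply/hasPn.
by rewrite addn0 take0 drop0 /= nax; apply/allP.
Qed.

(** Each cut point has the same number of elements of every member below it, namely a partial sum of
    [l], so it cuts all increasing sequences at the same position. *)
Lemma partite_separated (R : realType) r (l : ordered_partition r)
    (H : {fset {fset int}}) :
  {in H, forall e, #|` e| = r} -> is_partite R l H ->
  {in psums l, forall d, {in H &, forall e f,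
    separated (increasing_seq e) (increasing_seq f) d}}.
Proof.
move=> cardH [x [x_notint x_lt x_card]].
have neq i z : i <= size l -> x i != z%:~R%R.
  by move=> il; apply: contraNneq (x_notint i il) => ->; apply: intr_int.
have x_mono i : i <= size l -> (x 0 <= x i)%R.
  elim: i => // i IHi il; apply: (le_trans (IHi (ltnW il))).
  exact/ltW/x_lt.
pose below i (z : int) := (z%:~R < x i)%R.
have between e i : e \in H -> i <= size l ->
    count (fun z : int => (x 0 < z%:~R < x i)%R) e = sumn (take i l).
  move=> eH; elim: i => [|i IHi] il.
    rewrite take0 /=; apply/eqP; rewrite -leqn0 leqNgt -has_count.
    apply/hasPn => z _; apply/negP => /andP[z0 z1].
    by have := lt_trans z0 z1; rewrite ltxx.
  rewrite (take_nth 0 il) sumn_rcons -IHi; last exact: ltnW.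
  rewrite -(x_card e eH i il).
  have -> : #|` [fset z in e | (x i < z%:~R < x i.+1)%R]%fset| =
      count (fun z : int => (x i < z%:~R < x i.+1)%R) e.
    rewrite -size_filter.
    apply/perm_size/uniq_perm; rewrite ?filter_uniq ?fset_uniq // => z.
    by rewrite mem_filter !inE andbC.
  (* No integer equals [x i], so the counts over adjacent intervals add up. *)
  rewrite -count_predUI [X in _ + X](@eq_count _ _ pred0) ?count_pred0 ?addn0.
    apply: eq_count => z /=; have := neq i z (ltnW il).
    case: (ltgtP (x i) z%:~R%R) => //= [iz _|zi _].
      by rewrite andbF (le_lt_trans (x_mono i (ltnW il)) iz).
    by rewrite andbT orbF (lt_trans zi (x_lt i il)) andbT.
  by move=> z /=; case: (ltgtP (x i) z%:~R%R); rewrite ?andbF.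
(* The intervals together already contain [r] elements of [e], so none lies below [x 0]. *)
have above e z : e \in H -> z \in e -> (x 0 < z%:~R)%R.
  move=> eH ze; have := between e (size l) eH (leqnn _).
  rewrite take_size sumn_parts -[RHS](cardH e eH) => /eqP.
  rewrite -all_count => /allP/(_ z ze)/andP[]//.
move=> _ /mem_psums[i il ->] e f eH fH.
have countE g : g \in H -> count (below i.+1) (increasing_seq g) =
    sumn (take i.+1 l).
  move=> gH; rewrite -(between g) // (permP (permEl (perm_sort _ _))).
  by apply: eq_in_count => z zg; rewrite /below (above g z gH zg).
have down y z : (y <= z)%R -> below i.+1 z -> below i.+1 y.
  by rewrite /below => yz; apply: le_lt_trans; rewrite ler_int.
have /andP[/allP e_lt _] := take_count_downward (sorted_increasing_seq e) down.
have /andP[_ /allP f_ge] := take_count_downward (sorted_increasing_seq f) down.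
rewrite countE // in e_lt; rewrite countE // in f_ge.
apply/allrelP => y z /e_lt y_lt /f_ge; rewrite /= /below -leNgt => z_ge.
by rewrite -(ltr_int R); apply: lt_le_trans z_ge.
Qed.

Theorem theorem3p4 (R : realType) (r : nat) (r_gt0 : 0 < r)
  (l : ordered_partition r)
  (m : r.*2.-tuple bool -> nat)
  (m_gt0 : forall P : r.*2.-tuple bool, collectable P -> 0 < m P)
  (H : {fset {fset int}})
  (H_card : forall e : {fset int}, e \in H -> #|` e| = r)
  (H_disj : forall e f : {fset int}, e \in H -> f \in H -> e != f ->
     [disjoint e & f]%fset)
  (H_partite : is_partite R l H)
  (H_clique : forall P : r.*2.-tuple bool, collectable P ->
     forall K : {fset {fset int}}, (K `<=` H)%fset -> is_clique P K ->
     #|` K| <= m P) :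
  #|` H| <= 2 ^ (r - size l) *
    \sum_(c : (r - size l).+1.-tuple (ordered_partition r) | `[< is_chain l c >])
      \prod_(P in \bigcup_(k <- c) patterns_of k) m P.
Proof.
have size_l : size l <= r.
  by rewrite -[leqRHS](sumn_parts l) size_le_sumn // parts_gt0.
apply: leq_trans (iterated_bound_le _ _ _).
apply: card_le_iterated_bound => //; first by rewrite subnKC.
by split=> //; apply: partite_separated H_partite.
Qed.
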